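(* If $n\ge 1$, then $\mathcal{O}(\mathrm{LPF}_n^{\downarrow})=\mathsf{Av}_n(132)$.
   Context: Let $[n]=\{1,\ldots,n\}$ and let $\mathfrak{S}_n$ be the set of permutations of $[n]$ in one-line notation. A Lehmer parking function of length $n$ is a tuple $\alpha=(a_1,\ldots,a_n)\in[n]^n$ with $a_i\le n-i+1$ for all $i\in[n]$; $\mathrm{LPF}_n$ is the set of these, and $\mathrm{LPF}_n^{\downarrow}=\{\alpha\in\mathrm{LPF}_n: a_i\ge a_{i+1}\text{ for all }i\in[n-1]\}$. Cars $1,2,\ldots,n$ arrive in this order on a one-way street with spots $1,\ldots,n$; car $i$ parks in the first empty spot at or after its preference $a_i$. A tuple is a parking function if all cars park; every Lehmer parking function is a parking function. The outcome $\mathcal{O}(\alpha)$ is the permutation $\pi=\pi_1\cdots\pi_n\in\mathfrak{S}_n$ where $\pi_i=j$ means that spot $i$ is occupied by car $j$ at the end. $\mathcal{O}(\mathrm{LPF}_n^{\downarrow})=\{\mathcal{O}(\alpha):\alpha\in\mathrm{LPF}_n^{\downarrow}\}$. $\mathsf{Av}_n(132)$ is the set of $\pi\in\mathfrak{S}_n$ avoiding $132$, i.e. for which there are no indices $p<q<r$ with $\pi_p<\pi_r<\pi_q$. *)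

(* Defs.v *)
From mathcomp Require Import all_boot all_fingroup.

Set Implicit Arguments.
Unset Strict Implicit.
Unset Printing Implicit Defensive.

(* The set [n] = {1, ..., n} is represented by 'I_n = {0, ..., n-1}: car,     *)
(* spot and position k of the text is the ordinal of value k - 1.  The order  *)
(* comparisons are unaffected by this shift; wherever a value enters an       *)
(* arithmetic bound, it is shifted back with .+1.                             *)

Section Defs.

Variable n : nat.

Definition LPF : {set {ffun 'I_n -> 'I_n}} :=
  [set a : {ffun 'I_n -> 'I_n} | [forall i, (a i).+1 <= n - i.+1 + 1]].

Definition LPF_down : {set {ffun 'I_n -> 'I_n}} :=
  [set a in LPF | [forall i : 'I_n, forall j : 'I_n,
                     (j == i.+1 :> nat) ==> (a i >= a j)]].

(* s j is the car parked in spot j, if any. *)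
Definition street := {ffun 'I_n -> option 'I_n}.

(* A car that finds no empty spot at or after its preference p leaves the     *)
(* street unchanged.                                                          *)
Definition park (s : street) (car p : 'I_n) : street :=
  let available (j : 'I_n) := (p <= j) && (s j == None) in
  if [pick j | available j & [forall k, available k ==> (j <= k)]] is Some j
  then [ffun k => if k == j then Some car else s k]
  else s.

(* enum 'I_n lists the cars in increasing order. *)
Definition final_street (a : {ffun 'I_n -> 'I_n}) : street :=
  foldl (fun s i => park s i (a i)) [ffun=> None] (enum 'I_n).

(* None exactly when a is not a parking function, i.e., some car fails to     *)
(* park; otherwise Some pi, where pi i is the car parked in spot i.           *)
Definition outcome (a : {ffun 'I_n -> 'I_n}) : option 'S_n :=
  [pick pi : 'S_n | [forall i, final_street a i == Some (pi i)]].

Definition Av132 : {set 'S_n} :=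
  [set pi : 'S_n | ~~ [exists p : 'I_n, exists q : 'I_n, exists r : 'I_n,
     [&& p < q, q < r, pi p < pi r & pi r < pi q]]].

End Defs.

(* Main.v *)
Require Import Defs.
From mathcomp Require Import all_boot all_fingroup.

(** Let [s c] denote the spot where car [c] ends up, so that the outcome is the
    inverse of [s].  The parking procedure is summed up by a local condition,
    [park_rule]: car [c] parks at or after its preference, and every spot that
    it drives past holds an earlier car.  A permutation [s] satisfying this for
    all cars is the result of the simulation ([outcome_park_rule]), and such an
    [s] exists for every Lehmer parking function, since the [n - a c > c] spots
    from [a c] on cannot all be taken by the [c] earlier cars
    ([LPF_park_rule]).  The theorem becomes a statement about permutations.

    Suppose that preferences decrease weakly and that cars [x < y < z] form a
    132 pattern, parked at spots [s x < s z < s y].  Spot [s z] is still empty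
    when [y] arrives, so [y] prefers a spot after [s z]; the earlier car [x]
    then prefers one at least as far, yet it parks before [s z], which is absurd
    ([outcome_avoids_132]).

    Conversely, if the outcome avoids 132, let car [c] prefer the leftmost spot
    taken by one of the cars [0, ..., c] ([leftmost_spot]).  These preferences
    decrease weakly; they are Lehmer because [c + 1] distinct spots lie at or
    after the leftmost of them; and a spot strictly between the preference,
    taken by some [d <= c], and [s c] holds an earlier car than [c], for a later
    one would complete a 132 pattern. *)

(** * Counting in initial and final segments *)

Lemma card_ord_lt {n} m : m <= n -> #|[set d : 'I_n | d < m]| = m.
Proof.
move=> le_mn; have inj : injective (widen_ord le_mn).
  by move=> i j /(congr1 val) /= /val_inj.
rewrite -[RHS]card_ord -cardsT -(card_imset _ inj).
apply: eq_card => d; rewrite inE; apply/idP/imsetP => [lt_dm | [k _ ->]].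
  by exists (Ordinal lt_dm) => //; apply: val_inj.
exact: (ltn_ord k).
Qed.

Lemma card_ord_ge {n} p : p <= n -> #|[set k : 'I_n | p <= k]| = n - p.
Proof.
move=> le_pn; rewrite -[X in _ = _ - X](card_ord_lt p le_pn).
rewrite -[X in X - _](card_ord n) -(cardsC [set d : 'I_n | d < p]) addKn.
by apply: eq_card => k; rewrite !inE -leqNgt.
Qed.

(** * The local parking rule *)

Definition park_rule {n} (a s : 'I_n -> 'I_n) (c : 'I_n) : Prop :=
  a c <= s c /\
  forall k : 'I_n, a c <= k < s c -> exists2 d : 'I_n, d < c & s d = k.

Lemma park_at {n} (st : street n) (car p j : 'I_n) :
    p <= j -> st j = None -> (forall k : 'I_n, p <= k < j -> st k <> None) ->
  park st car p = [ffun k => if k == j then Some car else st k].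
Proof.
move=> le_pj st_j full; rewrite /park; case: pickP => [i | /(_ j)].
  case/andP=> /andP[le_pi /eqP st_i] /forallP min_i.
  suff -> : i = j by [].
  apply/val_inj/eqP; rewrite eqn_leq; have /implyP -> /= := min_i j.
    by rewrite leqNgt; apply/negP => lt_ij; apply: (full i); rewrite ?le_pi.
  by rewrite le_pj st_j eqxx.
rewrite le_pj st_j eqxx => /negP[]; apply/forallP=> k; apply/implyP.
case/andP=> le_pk /eqP st_k; rewrite leqNgt; apply/negP=> lt_kj.
by apply: (full k); rewrite ?le_pk.
Qed.

(** The rule is exactly what makes car [m] drive past occupied spots and then
    stop: the spots before [s m] hold cars [< m], already parked, whereas [s m]
    itself is reserved for [m] by injectivity of [s].  Hence after [m] arrivals
    the street shows the final arrangement with the cars [>= m] erased. *)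
Lemma prefix_street {n} (a : {ffun 'I_n -> 'I_n}) (s : 'S_n) m :
    (forall c, park_rule a s c) -> m <= n ->
  foldl (fun st i => park st i (a i)) [ffun=> None] (take m (enum 'I_n))
    = [ffun k => if (s^-1)%g k < m then Some ((s^-1)%g k) else None].
Proof.
move=> rule; elim: m => [|m IHm] lt_mn.
  by rewrite take0; apply/ffunP=> k; rewrite !ffunE.
pose c := Ordinal lt_mn; have [le_ac full] := rule c.
rewrite (take_nth c) ?size_enum_ord // -cats1 foldl_cat IHm ?(ltnW lt_mn) //=.
rewrite (nth_ord_enum c c) (park_at _ _ _ (s c)) //.
- apply/ffunP=> k; rewrite !ffunE ltnS [in RHS]leq_eqVlt.
  have -> : (k == s c) = ((s^-1)%g k == m :> nat).
    by rewrite -(inj_eq (@perm_inj _ (s^-1)%g)) permK -val_eqE.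
  by case: eqP => //= eq_m; congr Some; apply: val_inj.
- by rewrite ffunE permK /= ltnn.
- by move=> k /full[d lt_dc <-]; rewrite ffunE permK lt_dc.
Qed.

Lemma outcome_park_rule {n} (a : {ffun 'I_n -> 'I_n}) (s : 'S_n) :
  (forall c, park_rule a s c) -> outcome a = Some (s^-1)%g.
Proof.
move=> rule; have fin k : final_street a k = Some ((s^-1)%g k).
  have := prefix_street a s n rule (leqnn n).
  rewrite take_oversize ?size_enum_ord // /final_street => ->.
  by rewrite ffunE ltn_ord.
rewrite /outcome; case: pickP => [pi /forallP eq_pi | /(_ (s^-1)%g)/negP[]].
  by congr Some; apply/permP=> k; have := eq_pi k; rewrite fin => /eqP[].
by apply/forallP=> k; rewrite fin.
Qed.

(** Car [m] always finds a spot: at least [m + 1] spots lie at or after its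
    preference, and only [m] are taken.  Values of [s] on the cars [>= m] carry
    no meaning, which keeps the placement a total function throughout. *)
Lemma LPF_placement {n} (a : {ffun 'I_n -> 'I_n}) m : a \in LPF n -> m <= n ->
  exists2 s : {ffun 'I_n -> 'I_n},
    {in [pred c : 'I_n | c < m] &, injective s} &
    forall c : 'I_n, c < m -> park_rule a s c.
Proof.
rewrite inE => /forallP LPFa; elim: m => [|m IHm] lt_mn; first by exists a.
have [s inj_s rule] := IHm (ltnW lt_mn).
pose c := Ordinal lt_mn; pose taken := s @: [set d : 'I_n | d < m].
pose avail := [pred k : 'I_n | (a c <= k) && (k \notin taken)].
have [j0 av_j0] : exists j, avail j.
  apply/existsP; apply: contraT; rewrite negb_exists => /forallP none.
  have /subset_leq_card : [set k : 'I_n | a c <= k] \subset taken.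
    apply/subsetP=> k; rewrite inE => le_ak.
    by have := none k; rewrite /= le_ak negbK.
  move/leq_trans/(_ (leq_imset_card _ _)).
  rewrite (card_ord_lt m (ltnW lt_mn)) (card_ord_ge _ (ltnW (ltn_ord (a c)))).
  have := LPFa c; rewrite /= addn1 subnSK // ltn_subRL leq_subLR addnC ltnNge.
  by move/negbTE=> ->.
case: (arg_minnP val av_j0) => j /andP[le_aj free_j] min_j.
pose s' := [ffun d => if d == c then j else s d].
have s'_lt (d : 'I_n) : d < m -> s' d = s d.
  by move=> lt_dm; rewrite ffunE -val_eqE /= ltn_eqF.
have s'_c : s' c = j by rewrite ffunE eqxx.
have lt_or_c (d : 'I_n) : d < m.+1 -> d < m \/ d = c.
  by rewrite ltnS leq_eqVlt => /predU1P[eq_m | ]; [right; apply: val_inj | left].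
have s'_neq (d : 'I_n) : d < m -> s' d <> j.
  move=> lt_dm; rewrite s'_lt // => eq_j; case/negP: free_j.
  by rewrite -eq_j imset_f ?inE.
exists s' => [d e | d].
  rewrite !inE => /lt_or_c[lt_d | ->] /lt_or_c[lt_e | ->] //.
  - by rewrite !s'_lt //; apply: inj_s.
  - by rewrite s'_c => /(s'_neq d lt_d).
  - by rewrite s'_c => /esym/(s'_neq e lt_e).
case/lt_or_c=> [lt_d | ->].
  have [le_as full] := rule d lt_d.
  split; rewrite s'_lt // => k /full[e lt_ed <-].
  by exists e => //; rewrite s'_lt // (ltn_trans lt_ed).
split; rewrite s'_c // => k /andP[le_ak lt_kj].
have : ~~ avail k by apply: contraL lt_kj => /min_j; rewrite -leqNgt.
rewrite /= le_ak negbK => /imsetP[e]; rewrite inE => lt_e ->.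
by exists e; rewrite ?s'_lt.
Qed.

Lemma LPF_park_rule {n} (a : {ffun 'I_n -> 'I_n}) : a \in LPF n ->
  exists s : 'S_n, forall c, park_rule a s c.
Proof.
move=> LPFa; have [s inj_s rule] := LPF_placement a n LPFa (leqnn n).
have inj : injective s by move=> c d; apply: inj_s; rewrite inE.
exists (perm inj) => c; have [le_as full] := rule c (ltn_ord c).
split; rewrite permE // => k /full[d lt_dc <-].
by exists d; rewrite ?permE.
Qed.

(** * Weakly decreasing preferences and the pattern 132 *)

Lemma LPF_down_anti {n} (a : {ffun 'I_n -> 'I_n}) : a \in LPF_down n ->
  forall c d : 'I_n, c <= d -> a d <= a c.
Proof.
rewrite inE => /andP[_ /forallP adj] c [d lt_dn] /=.
elim: d lt_dn => [|d IHd] lt_dn.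
  rewrite leqn0 => /eqP c0.
  by rewrite (_ : Ordinal lt_dn = c) //; apply: val_inj.
rewrite leq_eqVlt => /predU1P[eq_c | ].
  by rewrite (_ : Ordinal lt_dn = c) //; apply: val_inj.
rewrite ltnS => /(IHd (ltnW lt_dn)); apply: leq_trans.
have /forallP/(_ (Ordinal lt_dn))/implyP := adj (Ordinal (ltnW lt_dn)).
exact.
Qed.

Lemma outcome_avoids_132 {n} (a : {ffun 'I_n -> 'I_n}) (s : 'S_n) :
    (forall c, park_rule a s c) -> (forall c d : 'I_n, c <= d -> a d <= a c) ->
  (s^-1)%g \in Av132 n.
Proof.
move=> rule anti; rewrite inE; apply/existsP=> -[p /existsP[q /existsP[r]]].
rewrite -{1 2}(permKV s p) -{1 2}(permKV s q) -{1 2}(permKV s r).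
move: (_ p) (_ q) (_ r) => x z y; rewrite !permK.
case/and4P=> lt_xz lt_zy lt_x_y lt_y_z.
have [le_x _] := rule x; have [_ full_y] := rule y.
have [le_yz | lt_zy'] := leqP (a y) (s z).
  (* Here [y] would drive past [s z], which the later car [z] finds empty. *)
  have [d lt_dy /perm_inj eq_dz] := full_y (s z) ltac:(by rewrite le_yz).
  by move: lt_y_z; rewrite ltnNge -eq_dz ltnW.
have := leq_trans lt_zy' (leq_trans (anti x y (ltnW lt_x_y)) le_x).
by rewrite ltnNge (ltnW lt_xz).
Qed.

(** Any preferences with outcome [s^-1] that decrease weakly lie at or below
    these: each car prefers a spot no further than its own, and no further than
    the preferences of the cars before it.  So this is the largest candidate,
    and avoiding 132 is what makes it work. *)
Definition leftmost_spot {n} (s : 'S_n) : {ffun 'I_n -> 'I_n} :=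
  [ffun c : 'I_n => s [arg min_(d < c | d <= c) s d]].

Lemma leftmost_spotP {n} (s : 'S_n) (c : 'I_n) :
  (exists2 d : 'I_n, d <= c & leftmost_spot s c = s d) /\
  (forall d : 'I_n, d <= c -> leftmost_spot s c <= s d).
Proof.
rewrite ffunE; case: arg_minnP => [|d le_dc min_d]; first exact: leqnn.
by split=> //; exists d.
Qed.

Lemma leftmost_spot_LPF_down {n} (s : 'S_n) : leftmost_spot s \in LPF_down n.
Proof.
rewrite !inE; apply/andP; split; apply/forallP=> c.
  have [_ min_c] := leftmost_spotP s c; set p := leftmost_spot s c in min_c *.
  have /subset_leq_card :
      s @: [set d : 'I_n | d < c.+1] \subset [set k : 'I_n | p <= k].
    by apply/subsetP=> _ /imsetP[d + ->]; rewrite !inE; apply: min_c.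
  rewrite (card_imset _ (@perm_inj _ s)) (card_ord_lt _ (ltn_ord c)).
  rewrite (card_ord_ge _ (ltnW (ltn_ord p))).
  by rewrite addn1 subnSK // !ltn_subRL addnC.
apply/forallP=> d; apply/implyP=> /eqP eq_d.
have [[e le_ec ->] _] := leftmost_spotP s c.
by apply: (leftmost_spotP s d).2; rewrite eq_d ltnW.
Qed.

Lemma leftmost_spot_park_rule {n} (s : 'S_n) :
  (s^-1)%g \in Av132 n -> forall c, park_rule (leftmost_spot s) s c.
Proof.
rewrite inE => avoid c; have [[d le_dc eq_d] min_c] := leftmost_spotP s c.
split=> [|k /andP[]]; first exact: min_c.
rewrite eq_d => le_dk lt_kc; exists ((s^-1)%g k); last exact: permKV.
rewrite ltnNge; apply: contra avoid => le_ck.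
(* If [k] held a later car than [c], spots [s d < k < s c] would carry 132. *)
have lt_ck : c < (s^-1)%g k.
  rewrite ltn_neqAle le_ck andbT; apply: contraTneq lt_kc => /val_inj ->.
  by rewrite permKV ltnn.
have lt_dc : d < c.
  rewrite ltn_neqAle le_dc andbT; apply: contraTneq lt_kc => /val_inj <-.
  by rewrite -leqNgt.
have lt_dk : s d < k.
  rewrite ltn_neqAle le_dk andbT; apply: contraTneq lt_ck => /val_inj <-.
  by rewrite permK -leqNgt.
apply/existsP; exists (s d); apply/existsP; exists k.
apply/existsP; exists (s c).
by rewrite !permK lt_dk lt_kc lt_dc lt_ck.
Qed.

Theorem theorem4p2 (n : nat) (hn : 1 <= n) :
  [set outcome a | a in LPF_down n] = [set Some pi | pi in Av132 n].
Proof.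
apply/setP=> o; apply/imsetP/imsetP=> [[a a_down ->] | [pi pi_av ->]].
  have LPFa : a \in LPF n by move: a_down; rewrite inE => /andP[].
  have [s rule] := LPF_park_rule a LPFa.
  exists (s^-1)%g; last exact: outcome_park_rule.
  by apply: outcome_avoids_132 rule _; apply: LPF_down_anti.
rewrite -(invgK pi) in pi_av *.
exists (leftmost_spot pi^-1%g); first exact: leftmost_spot_LPF_down.
by rewrite (outcome_park_rule _ _ (leftmost_spot_park_rule _ pi_av)).
Qed.
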